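(* Let $G$ be a $2$-connected finite simple graph. Then $G$ contains a cycle passing through all vertices of $G$ of degree at least $\widetilde{\alpha}(G)$, where $\widetilde{\alpha}(G)$ denotes the bipartite-hole-number of $G$.
   Context: All graphs are finite and simple. A graph is $2$-connected if it has at least three vertices, is connected, and remains connected after the deletion of any single vertex. For positive integers $s,t$, an $(s,t)$-bipartite-hole in a graph $G$ consists of two disjoint sets of vertices $S,T\subseteq V(G)$ with $|S|=s$ and $|T|=t$ such that there is no edge of $G$ with one endpoint in $S$ and the other in $T$. The bipartite-hole-number $\widetilde{\alpha}(G)$ is the minimum integer $k$ such that there exist positive integers $s$ and $t$ with $s+t=k+1$ for which $G$ does not contain an $(s,t)$-bipartite-hole. *)

(* Defs.v *)
(* A finite simple graph is a symmetric irreflexive relation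
   [e : rel V] on a finType [V]. *)
From mathcomp Require Import all_boot.

Set Implicit Arguments.
Unset Strict Implicit.
Unset Printing Implicit Defensive.

Definition induced_rel (V : finType) (e : rel V) (A : {set V}) : rel V :=
  [rel x y | [&& x \in A, y \in A & e x y]].

Definition connected_on (V : finType) (e : rel V) (A : {set V}) : bool :=
  [forall x in A, forall y in A, connect (induced_rel e A) x y].

Definition two_connected (V : finType) (e : rel V) : bool :=
  [&& 2 < #|V|, connected_on e [set: V] &
      [forall v, connected_on e [set~ v]]].

Definition degree (V : finType) (e : rel V) (x : V) : nat :=
  #|[set y | e x y]|.

(* The bound on the size excludes the degenerate [cycle]s [::] and [:: x; y]. *)
Definition graph_cycle (V : finType) (e : rel V) (c : seq V) : bool :=
  (2 < size c) && ucycleb e c.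

Definition bipartite_hole (V : finType) (e : rel V) (s t : nat)
    (A B : {set V}) : bool :=
  [&& [disjoint A & B], #|A| == s, #|B| == t &
      [forall x in A, forall y in B, ~~ e x y]].

Definition has_bipartite_hole (V : finType) (e : rel V) (s t : nat) : bool :=
  [exists A : {set V}, exists B : {set V}, bipartite_hole e s t A B].

(* Bounding [s] and [t] by [k.+2] makes the predicate boolean, as [ex_minn]
   requires; it loses nothing since [s + t = k.+1], see [avoids_hole_sumP]. *)
Definition avoids_hole_sum (V : finType) (e : rel V) (k : nat) : bool :=
  [exists s : 'I_k.+2, exists t : 'I_k.+2,
    [&& 0 < s, 0 < t, s + t == k.+1 & ~~ has_bipartite_hole e s t]].

Lemma avoids_hole_sumP (V : finType) (e : rel V) (k : nat) :
  reflect (exists s t : nat, [/\ 0 < s, 0 < t, s + t = k.+1 &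
                                 ~~ has_bipartite_hole e s t])
          (avoids_hole_sum e k).
Proof.
apply: (iffP existsP) => [[s /existsP[t /and4P[s0 t0 /eqP st h]]]|].
  by exists s, t.
case=> s [t [s0 t0 st h]].
have sk : s < k.+2 by rewrite ltnS -st leq_addr.
have tk : t < k.+2 by rewrite ltnS -st leq_addl.
exists (Ordinal sk); apply/existsP; exists (Ordinal tk).
by rewrite /= s0 t0 st eqxx.
Qed.

Lemma avoids_hole_sum_ex (V : finType) (e : rel V) :
  exists k, avoids_hole_sum e k.
Proof.
exists #|V|.+1; apply/avoids_hole_sumP; exists #|V|.+1, 1.
split=> //; first by rewrite addn1.
apply/existsP=> -[A /existsP[B /and4P[_ /eqP cA _ _]]].
by have := max_card (mem A); rewrite cA ltnn.
Qed.

Definition bipartite_hole_number (V : finType) (e : rel V) : nat :=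
  ex_minn (avoids_hole_sum_ex e).

(* Main.v *)
(* Fix s + t = k + 1 such that there is no (s,t)-bipartite-hole, where k is the
   bipartite-hole-number, and let H be the set of vertices of degree at least k.
   The key fact is that a path on at least three vertices whose two ends are in
   H closes up to a cycle through all its vertices: otherwise the neighbours of
   the ends, shifted along the path, form an (s,t)-hole. Hence, as in the
   Bondy-Chvatal closure, an edge between two vertices of H may be added without
   changing whether some cycle contains H; once H is a clique, this is clear if
   H has at least three vertices. If H has two vertices, 2-connectedness
   yields a path on at least three vertices between them, which closes up. *)
Require Import Defs.
From mathcomp Require Import all_boot zify.

Set Implicit Arguments.
Unset Strict Implicit.
Unset Printing Implicit Defensive.

(** * Half-open segments of a sequence, and cycles assembled from three pieces *)

Definition seg (T : Type) (w : seq T) (i j : nat) : seq T :=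
  take (j - i) (drop i w).

Lemma seg_full (T : Type) (w : seq T) : seg w 0 (size w) = w.
Proof. by rewrite /seg drop0 subn0 take_size. Qed.

Lemma seg_cat (T : Type) (w : seq T) (i j k : nat) :
  i <= j <= k -> seg w i j ++ seg w j k = seg w i k.
Proof.
case/andP=> ij jk; rewrite /seg.
have -> : k - i = (j - i) + (k - j) by lia.
by rewrite takeD drop_drop subnK.
Qed.

Lemma size_seg (T : Type) (w : seq T) (i j : nat) :
  i <= j <= size w -> size (seg w i j) = j - i.
Proof. by move=> h; rewrite size_takel // size_drop; lia. Qed.

Lemma sorted_seg (T : Type) (e : rel T) (w : seq T) (i j : nat) :
  sorted e w -> sorted e (seg w i j).
Proof. by move=> h; apply/take_sorted/drop_sorted. Qed.

Lemma sorted_rev_seg (T : Type) (e : rel T) (w : seq T) (i j : nat) :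
  symmetric e -> sorted e w -> sorted e (rev (seg w i j)).
Proof.
move=> e_sym /(sorted_seg i j) h; rewrite rev_sorted.
by rewrite (eq_sorted (e' := e)) // => x y; rewrite e_sym.
Qed.

Lemma head_seg (T : Type) (x0 : T) (w : seq T) (i j : nat) :
  i < j <= size w -> head x0 (seg w i j) = nth x0 w i.
Proof. by move=> h; rewrite -nth0 nth_take ?nth_drop ?addn0 //; lia. Qed.

Lemma last_seg (T : Type) (x0 : T) (w : seq T) (i j : nat) :
  i < j <= size w -> last x0 (seg w i j) = nth x0 w j.-1.
Proof.
move=> h; rewrite -nth_last size_seg ?nth_take ?nth_drop; try lia.
by congr nth; lia.
Qed.

Lemma head_rev (T : Type) (x0 : T) (s : seq T) : head x0 (rev s) = last x0 s.
Proof. by case/lastP: s => // s x; rewrite rev_rcons last_rcons. Qed.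

Lemma last_rev (T : Type) (x0 : T) (s : seq T) : last x0 (rev s) = head x0 s.
Proof. by rewrite -head_rev revK. Qed.

Lemma cycle_cat3 (T : Type) (e : rel T) (x0 : T) (A B C : seq T) :
  0 < size A -> 0 < size B -> 0 < size C ->
  sorted e A -> sorted e B -> sorted e C ->
  e (last x0 A) (head x0 B) -> e (last x0 B) (head x0 C) ->
  e (last x0 C) (head x0 A) -> cycle e (A ++ B ++ C).
Proof.
case: A => // a A; case: B => // b B; case: C => // c C _ _ _ /= sA sB sC AB BC CA.
by rewrite rcons_cat cat_path /= rcons_cat cat_path /= rcons_path sA sB sC AB BC CA.
Qed.

(** [z] collects the vertices off [w] that the cycle picks up; the crossings below need at most
    two. *)
Lemma cycle_through_perm (V : finType) (e : rel V) (w z c : seq V) :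
  uniq (w ++ z) -> 2 < size w -> perm_eq c (w ++ z) -> cycle e c ->
  exists c, graph_cycle e c /\ {subset w <= c}.
Proof.
move=> uwz sw pc cc; exists c; split=> [|x xw].
  by rewrite /graph_cycle /ucycleb cc (perm_uniq pc) uwz !andbT (perm_size pc) size_cat
    (leq_trans sw) ?leq_addr.
by rewrite (perm_mem pc) mem_cat xw.
Qed.

(** * Consequences of hole-freeness and of 2-connectedness *)

(** Otherwise trimming the two sets to exactly [s] and [t] elements leaves a hole. The sets may
    overlap, which accounts for the alternative [x == y]. *)
Lemma no_bipartite_hole_meet (V : finType) (e : rel V) (s t : nat) (S T : {set V}) :
  ~~ has_bipartite_hole e s t -> s <= #|S| -> t <= #|T| ->
  exists x y, [/\ x \in S, y \in T & (x == y) || e x y].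
Proof.
move=> noh /card_geqP[A [uA sA AS]] /card_geqP[B [uB sB BT]].
have [/existsP[x /andP[xA /existsP[y /andP[yB xy]]]]|h] :=
  boolP [exists x in A, exists y in B, (x == y) || e x y].
  by exists x, y; rewrite AS ?BT.
case/negP: noh; apply/existsP; exists [set x in A]; apply/existsP; exists [set x in B].
have hh x y : x \in A -> y \in B -> (x == y) || e x y = false.
  move=> xA yB; apply: contraNF h => xy; apply/existsP; exists x; rewrite xA.
  by apply/existsP; exists y; rewrite yB.
apply/and4P; split.
- rewrite disjoint_subset; apply/subsetP=> x; rewrite !inE => xA.
  by apply/negP=> xB; have := hh x x xA xB; rewrite eqxx.
- by rewrite cardsE (card_uniqP uA) sA.
- by rewrite cardsE (card_uniqP uB) sB.
- apply/forallP=> x; apply/implyP; rewrite inE => xA.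
  apply/forallP=> y; apply/implyP; rewrite inE => yB.
  by have := hh x y xA yB; case: (e x y); rewrite ?orbT.
Qed.

(** A path from [u] to a third vertex avoiding [v] starts with a neighbour [b] of [u] other than
    [v]; a path from [b] to [v] avoiding [u] then extends the edge from [u] to [b]. *)
Lemma two_connected_path (V : finType) (e : rel V) (u v : V) :
  symmetric e -> two_connected e -> u != v ->
  exists p, [/\ path e u p, last u p = v, uniq (u :: p) & 1 < size p].
Proof.
move=> e_sym /and3P[V3 _ /forallP conn] uv.
have conn_path z x y : x != z -> y != z -> exists p,
    [/\ path e x p, last x p = y, uniq (x :: p) & z \notin x :: p].
  move=> xz yz; have /forallP/(_ x) := conn z.
  rewrite !inE xz => /forallP/(_ y); rewrite !inE yz => /connectP[p0 ep yE].
  rewrite {y}yE in yz *; case/shortenP: ep yz => p ep up _ yz; exists p; split=> //.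
    by apply: sub_path ep => a b /and3P[].
  rewrite inE negb_or eq_sym xz /=; apply/negP; elim: p x ep {up yz xz} => //= a p IH x.
  case/andP=> /and3P[_ az _] pp; rewrite inE => /orP[/eqP zE|]; last exact: IH pp.
  by rewrite !inE zE eqxx in az.
have [a /andP[au av]] : exists a, (a != u) && (a != v).
  apply/existsP; apply: contraLR V3; rewrite negb_exists => /forallP h.
  rewrite -leqNgt; have -> : 2 = #|[set u; v]| by rewrite cards2 uv.
  rewrite -cardsT; apply/subset_leq_card/subsetP=> x _; rewrite !inE.
  by move: (h x); rewrite negb_and !negbK.
have [[|b p] [/= epu lp up vp]] := conn_path v u a uv av.
  by rewrite lp eqxx in au.
have bv : b != v by move: vp; rewrite !inE !negb_or => /and3P[_ + _]; rewrite eq_sym.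
have bu : b != u by move: up; rewrite inE negb_or eq_sym => /andP[/andP[]].
case/andP: epu => eub _.
have vu : v != u by rewrite eq_sym.
have [q [eq lq uq nuq]] := conn_path u b v bu vu.
exists (b :: q); split=> //=; first by rewrite eub.
- by move: uq nuq => /= -> ->.
- by case: q lq {eq uq nuq} => //= bvE; rewrite bvE eqxx in bv.
Qed.

(** * Rearranging a path with ends [u] and [v] into a cycle *)

Section Crossings.
Context (V : finType) (e : rel V) (x0 : V) (w : seq V).
Context (e_sym : symmetric e) (uw : uniq w) (pw : sorted e w) (w3 : 2 < size w).
Local Notation "w_( i )" := (nth x0 w i) (format "w_( i )").
Local Notation u := (nth x0 w 0).
Local Notation v := (nth x0 w (size w).-1).
Local Notation cyclable := (exists c, graph_cycle e c /\ {subset w <= c}).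

Let split3 (i j : nat) : i <= j <= size w ->
  w = seg w 0 i ++ seg w i j ++ seg w j (size w).
Proof. by move=> h; rewrite !seg_cat ?seg_full //; lia. Qed.

Let seg3_cycle (A B C z : seq V) :
  (forall x, x \in z -> x \notin w) -> uniq z ->
  0 < size A -> 0 < size B -> 0 < size C ->
  sorted e A -> sorted e B -> sorted e C ->
  e (last x0 A) (head x0 B) -> e (last x0 B) (head x0 C) ->
  e (last x0 C) (head x0 A) -> perm_eq (A ++ B ++ C) (w ++ z) -> cyclable.
Proof.
move=> zw uz A0 B0 C0 sA sB sC AB BC CA pABC.
apply: (cycle_through_perm _ w3 pABC); last exact: (cycle_cat3 (x0 := x0)).
by rewrite cat_uniq uw uz andbT /=; apply/hasPn=> x /zw.
Qed.

Let segE := (size_rev, size_seg, head_rev, last_rev, head_seg, last_seg,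
  sorted_seg, sorted_rev_seg).

Lemma ends_adjacent : e u v -> cyclable.
Proof.
(* The cuts after the first two vertices only serve to make all three pieces nonempty. *)
move=> uv; apply: (seg3_cycle (A := seg w 0 1) (B := seg w 1 2)
  (C := seg w 2 (size w)) (z := [::])) => //; rewrite ?segE //=; try lia.
- by apply: (sortedP x0 pw); lia.
- by apply: (sortedP x0 pw); lia.
- by rewrite e_sym.
- by rewrite cats0 -split3 //; lia.
Qed.

(** The cycle runs from [u] to [w_(a.-1)], jumps to [w_(b.+1)], goes on to [v], jumps to [w_(b)] and
    returns backwards to [w_(a)], then [u]. *)
Lemma cross_pred_succ (a b : nat) : 0 < a -> a <= b -> b.+1 < size w ->
  e u w_(a) -> e v w_(b) -> e w_(a.-1) w_(b.+1) -> cyclable.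
Proof.
move=> a0 ab bn ua vb xy; apply: (seg3_cycle (A := seg w 0 a)
  (B := seg w b.+1 (size w)) (C := rev (seg w a b.+1)) (z := [::]));
  rewrite ?segE //=; try lia.
- by rewrite e_sym.
- rewrite cats0 [X in perm_eq _ X](@split3 a b.+1); last lia.
  by rewrite perm_cat2l perm_catC perm_cat2r perm_rev.
Qed.

(** The cycle runs from [u] to [w_(j)], jumps to [v], goes backwards to [w_(k.+1)], jumps to
    [w_(j.+1)] and goes forwards to [w_(k)], then [u]. *)
Lemma cross_succ_succ (j k : nat) : j < k -> k.+1 < size w ->
  e v w_(j) -> e u w_(k) -> e w_(j.+1) w_(k.+1) -> cyclable.
Proof.
move=> jk kn vj uk xy; apply: (seg3_cycle (A := seg w 0 j.+1)
  (B := rev (seg w k.+1 (size w))) (C := seg w j.+1 k.+1) (z := [::]));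
  rewrite ?segE //=; try lia.
- by rewrite e_sym.
- by rewrite e_sym.
- by rewrite e_sym.
- rewrite cats0 [X in perm_eq _ X](@split3 j.+1 k.+1); last lia.
  by rewrite perm_cat2l perm_catC perm_cat2l perm_rev.
Qed.

(** The cycle runs from [u] to [w_(b)], jumps to [v], goes backwards to [w_(b.+1)] and returns to
    [u] through [z]. *)
Lemma cross_out_succ (z : V) (b : nat) : z \notin w -> b.+1 < size w ->
  e u z -> e v w_(b) -> e z w_(b.+1) -> cyclable.
Proof.
move=> zw bn uz vb xy; apply: (seg3_cycle (A := seg w 0 b.+1)
  (B := rev (seg w b.+1 (size w))) (C := [:: z]) (z := [:: z]));
  rewrite ?segE //=; try lia.
- by move=> x; rewrite inE => /eqP->.
- by rewrite e_sym.
- by rewrite e_sym.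
- by rewrite e_sym.
- rewrite catA perm_cat2r -[X in perm_eq _ X]seg_full -(@seg_cat _ w 0 b.+1 (size w)); last lia.
  by rewrite perm_cat2l perm_rev.
Qed.

(** The cycle runs from [u] to [w_(a.-1)], passes through [z] to [v] and goes backwards to [w_(a)],
    then [u]. *)
Lemma cross_pred_out (z : V) (a : nat) : z \notin w -> 0 < a < size w ->
  e v z -> e u w_(a) -> e w_(a.-1) z -> cyclable.
Proof.
move=> zw an vz ua xy; apply: (seg3_cycle (A := seg w 0 a)
  (B := [:: z]) (C := rev (seg w a (size w))) (z := [:: z]));
  rewrite ?segE //=; try lia.
- by move=> x; rewrite inE => /eqP->.
- by rewrite e_sym.
- by rewrite e_sym.
- rewrite -[X in perm_eq _ (X ++ _)]seg_full -(@seg_cat _ w 0 a (size w)); last lia.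
  by rewrite -catA perm_cat2l -cat1s perm_catC perm_cat2r perm_rev.
Qed.

Lemma common_out (z : V) : z \notin w -> e u z -> e v z -> cyclable.
Proof.
move=> zw uz vz; apply: (seg3_cycle (A := seg w 0 1)
  (B := seg w 1 (size w)) (C := [:: z]) (z := [:: z])); rewrite ?segE //=; try lia.
- by move=> x; rewrite inE => /eqP->.
- by apply: (sortedP x0 pw); lia.
- by rewrite e_sym.
- by rewrite catA seg_cat ?seg_full //; lia.
Qed.

Lemma cross_out_out (y z : V) : y \notin w -> z \notin w -> y != z ->
  e u y -> e v z -> e y z -> cyclable.
Proof.
move=> yw zw yz uy vz xy; apply: (seg3_cycle (A := w)
  (B := [:: z]) (C := [:: y]) (z := [:: z; y])) => //=; try lia.
- by move=> x; rewrite !inE => /orP[] /eqP->.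
- by rewrite inE eq_sym yz.
- by rewrite -nth_last.
- by rewrite e_sym.
- by rewrite -nth0 e_sym.
Qed.

End Crossings.

(** * Counting neighbours of the two ends to find a crossing *)

Section PathClosing.
Context (V : finType) (e : rel V) (x0 : V) (w : seq V).
Context (e_sym : symmetric e) (e_irr : irreflexive e).
Context (uw : uniq w) (pw : sorted e w) (w3 : 2 < size w).
Local Notation "w_( i )" := (nth x0 w i) (format "w_( i )").
Local Notation u := (nth x0 w 0).
Local Notation v := (nth x0 w (size w).-1).

Let nth_in (i : nat) : i < size w -> w_(i) \in w.
Proof. exact: mem_nth. Qed.

Let nth_eq (i j : nat) : i < size w -> j < size w -> (w_(i) == w_(j)) = (i == j).
Proof. by move=> iw jw; rewrite nth_uniq. Qed.

Let out (z : V) : {set V} := [set y | e z y & y \notin w].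
(** Neighbours on the path are recorded by index, so that they can be shifted before being turned
    back into vertices. *)
Let below (z : V) (m : nat) := [set i : 'I_(size w) | e z w_(i) & i < m].
Let above (z : V) (m : nat) := [set i : 'I_(size w) | e z w_(i) & m <= i].

Let card_shift (f : nat -> nat) (A : {set 'I_(size w)}) :
  {in A, forall i : 'I_(size w), f i < size w} ->
  {in A &, forall i j : 'I_(size w), f i = f j -> i = j} ->
  #|[set w_(f i) | i : 'I_(size w) in A]| = #|A|.
Proof.
move=> fw finj; apply: card_in_imset => i j iA jA /eqP.
by rewrite nth_eq ?fw // => /eqP; apply: finj.
Qed.

Let card_out_shift (z : V) (f : nat -> nat) (A : {set 'I_(size w)}) :
  {in A, forall i : 'I_(size w), f i < size w} ->
  {in A &, forall i j : 'I_(size w), f i = f j -> i = j} ->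
  #|out z :|: [set w_(f i) | i : 'I_(size w) in A]| = #|out z| + #|A|.
Proof.
move=> fw finj; rewrite cardsU card_shift //.
suff -> : out z :&: [set w_(f i) | i : 'I_(size w) in A] = set0 by rewrite cards0 subn0.
apply/setP=> x; rewrite !inE; apply/negP=> /andP[/andP[_ /negP xw] /imsetP[i iA xE]].
by apply: xw; rewrite xE nth_in ?fw.
Qed.

Let degree_split (z : V) (m : nat) :
  degree e z = #|out z| + #|below z m| + #|above z m|.
Proof.
rewrite /degree -(cardsID [set x in w]) addnC -addnA; congr addn.
  by apply: eq_card => x; rewrite !inE andbC.
have -> : #|below z m| + #|above z m| = #|below z m :|: above z m|.
  rewrite cardsU; suff -> : below z m :&: above z m = set0 by rewrite cards0 subn0.
  by apply/setP=> i; rewrite !inE; case: (e _ _); lia.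
rewrite -(@card_shift id); last 2 first.
- by move=> i _; apply: ltn_ord.
- by move=> i j _ _; apply: val_inj.
apply: eq_card => x; rewrite !inE; apply/andP/imsetP => [[zx xw]|[i iA ->]].
  have xi : index x w < size w by rewrite index_mem.
  by exists (Ordinal xi); rewrite ?inE /= nth_index // zx /=; lia.
by rewrite nth_in //; move: iA; rewrite !inE -andb_orr => /andP[].
Qed.

(* On [w], neighbours of [u] are replaced by their predecessors and neighbours
   of [v] by their successors; let [i] be least such that [u] has [s] neighbours
   off [w] or before index [i]. If [v] has [t] neighbours off [w] or from [i.-1]
   on, any edge between these two sets closes [w] up. Otherwise [v] has [s]
   neighbours before [i.-1] and [u] has [t] neighbours from [i.-1] on, and the
   successors of both are used. *)
Lemma path_closing (s t : nat) :
  0 < s -> 0 < t -> ~~ has_bipartite_hole e s t ->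
  s + t <= (degree e u).+1 -> s + t <= (degree e v).+1 ->
  exists c, graph_cycle e c /\ {subset w <= c}.
Proof.
move=> s0 t0 noh du dv.
have [uv|uv] := boolP (e u v); first exact: ends_adjacent e_sym uw pw w3 uv.
(* These three facts keep the shifted indices on the path; [u_lt] is where non-adjacency of the ends
   enters. *)
have u_gt0 (a : 'I_(size w)) : e u w_(a) -> 0 < a.
  by case: (posnP a) => // ->; rewrite e_irr.
have u_lt (a : 'I_(size w)) : e u w_(a) -> a.+1 < size w.
  have an := ltn_ord a; case: ltnP => // na.
  have -> : nat_of_ord a = (size w).-1 by lia.
  by rewrite (negPf uv).
have v_lt (b : 'I_(size w)) : e v w_(b) -> b.+1 < size w.
  have bn := ltn_ord b; case: ltnP => // nb.
  have -> : nat_of_ord b = (size w).-1 by lia.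
  by rewrite e_irr.
(* The whole path suffices: [u] has at least [s + t - 1], hence at least [s], neighbours. *)
have ex_i : exists i, s <= #|out u| + #|below u i|.
  exists (size w); have := degree_split u (size w).
  suff -> : #|above u (size w)| = 0 by lia.
  by apply: eq_card0 => i; rewrite !inE leqNgt ltn_ord andbF.
case: (ex_minnP ex_i) => i si i_min.
(* The cutoff [i.-1] ensures [a <= b] for [a] in [below u i] and [b] in [above v i.-1], as
   [cross_pred_succ] requires. *)
have [ti|ti] := leqP t (#|out v| + #|above v i.-1|).
  have [||x [y [xS yT xy]]] := @no_bipartite_hole_meet _ _ _ _
    (out u :|: [set w_(a.-1) | a : 'I_(size w) in below u i])
    (out v :|: [set w_(b.+1) | b : 'I_(size w) in above v i.-1]) noh.
  - rewrite (@card_out_shift _ predn) // => [a _|a b].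
      exact: leq_ltn_trans (leq_pred _) (ltn_ord a).
    rewrite !inE => /andP[/u_gt0 a0 _] /andP[/u_gt0 b0 _] ab.
    by apply: val_inj => /=; lia.
  - rewrite (@card_out_shift _ succn) // => [b|a b _ _ [/val_inj] //].
    by rewrite inE => /andP[/v_lt].
  move: xS yT; rewrite !inE => /orP[/andP[ux xw]|/imsetP[a]];
    last rewrite inE => /andP[ua ai xE]; move=> /orP[/andP[vy yw]|/imsetP[b]];
    try rewrite inE => /andP[vb bi yE].
  - case: eqVneq xy => [xE _|nxy /= exy];
    last exact (cross_out_out e_sym uw pw w3 xw yw nxy ux vy exy).
    by rewrite -xE in vy; exact (common_out e_sym uw pw w3 xw ux vy).
  - case/orP: xy => [/eqP xE|xy]; last by rewrite yE in xy;
      refine (cross_out_succ e_sym uw pw w3 xw (v_lt _ vb) ux vb xy).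
    by rewrite xE yE nth_in ?v_lt in xw.
  - have a0 := u_gt0 _ ua; have an := ltn_ord a.
    case/orP: xy => [/eqP xE'|xy]; last by rewrite xE in xy;
      refine (cross_pred_out e_sym uw pw w3 yw _ vy ua xy); rewrite a0.
    by case/negP: yw; rewrite -xE' xE nth_in //; lia.
  - have a0 := u_gt0 _ ua; have an := ltn_ord a; have bn := v_lt _ vb.
    rewrite xE yE nth_eq // in xy; last lia.
    case/orP: xy => [|xy]; first lia.
    by refine (cross_pred_succ e_sym uw pw w3 a0 _ bn ua vb xy); lia.
(* For [i = 0], the cutoff [i.-1] is also [0], so [ti] would bound the whole degree of [v] below
   [t]. *)
have i0 : 0 < i.
  rewrite lt0n; apply: contraTN ti => /eqP->; rewrite -leqNgt.
  suff b0 : #|below v 0| = 0 by have := degree_split v 0; rewrite b0 addn0 /=; lia.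
  by apply: eq_card0 => j; rewrite !inE andbF.
have ui : #|out u| + #|below u i.-1| < s.
  by rewrite ltnNge; apply/negP=> /i_min; lia.
(* From at least [s + t - 1] neighbours of each end, remove at most [t - 1] of [v] off the path or
   from [i.-1] on, and at most [s - 1] of [u] off the path or before [i.-1]. *)
have vs : s <= #|below v i.-1| by have := degree_split v i.-1; lia.
have ut : t <= #|above u i.-1| by have := degree_split u i.-1; lia.
have [||x [y [/imsetP[j + xE] /imsetP[k + yE] xy]]] := @no_bipartite_hole_meet _ _ _ _
    [set w_(j.+1) | j : 'I_(size w) in below v i.-1]
    [set w_(k.+1) | k : 'I_(size w) in above u i.-1] noh.
- rewrite (@card_shift succn) //.
    by move=> j; rewrite inE => /andP[/v_lt].
  by move=> a b _ _ [/val_inj].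
- rewrite (@card_shift succn) //.
    by move=> j; rewrite inE => /andP[/u_lt].
  by move=> a b _ _ [/val_inj].
rewrite !inE => /andP[vj ji] /andP[uk ki].
have jn := v_lt _ vj; have kn := u_lt _ uk.
rewrite xE yE nth_eq // in xy.
(* Since [j < i.-1 <= k], the two successors differ and come in the order that [cross_succ_succ]
   needs. *)
case/orP: xy => [|xy]; first lia.
by refine (cross_succ_succ e_sym uw pw w3 _ kn vj uk xy); lia.
Qed.

End PathClosing.

Lemma uniq_path_closing (V : finType) (e : rel V) (x : V) (p : seq V) (s t : nat) :
  symmetric e -> irreflexive e -> path e x p -> uniq (x :: p) -> 1 < size p ->
  0 < s -> 0 < t -> ~~ has_bipartite_hole e s t ->
  s + t <= (degree e x).+1 -> s + t <= (degree e (last x p)).+1 ->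
  exists c, graph_cycle e c /\ {subset x :: p <= c}.
Proof.
move=> e_sym e_irr xp up p2 s0 t0 noh dx dy.
apply: (@path_closing _ e x (x :: p) e_sym e_irr up xp p2 s t) => //.
by rewrite nth_last.
Qed.

(** * Reduction to a clique by adding edges *)

Lemma clique_cycle (V : finType) (e : rel V) (H : {set V}) :
  2 < #|H| -> {in H &, forall x y, x != y -> e x y} ->
  exists c, graph_cycle e c /\ {subset H <= c}.
Proof.
move=> H3 clH; exists (enum H); split=> [|x]; last by rewrite mem_enum.
rewrite /graph_cycle /ucycleb enum_uniq -cardE H3 andbT /=.
have : {in enum H &, forall x y, x != y -> e x y}.
  by move=> x y; rewrite !mem_enum; apply: clH.
have := enum_uniq H; rewrite cardE in H3; case: (enum H) H3 => // x p p2 up clp.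
rewrite /= rcons_path; apply/andP; split; last first.
  case: p p2 up clp => //= y p _ /andP[xp _] clp.
  apply: clp; rewrite ?mem_head // 1?inE ?mem_last ?orbT //.
  by apply: contraNneq xp => <-; apply: mem_last.
have : pairwise [rel a b | a != b] (x :: p) by rewrite -uniq_pairwise.
move/pairwise_sorted; apply: (sub_in_sorted (P := mem (x :: p))) => //.
by apply/allP.
Qed.

Section AddEdge.
Context (V : finType) (e : rel V) (u v : V).

Definition add_edge : rel V :=
  [rel x y | [|| e x y, (x == u) && (y == v) | (x == v) && (y == u)]].

Lemma add_edge_sym : symmetric e -> symmetric add_edge.
Proof.
move=> e_sym x y; rewrite /add_edge /= e_sym; congr orb.
by rewrite orbC; congr orb; rewrite andbC.
Qed.

Lemma add_edge_irr : u != v -> irreflexive e -> irreflexive add_edge.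
Proof.
move=> uv e_irr x; rewrite /add_edge /= e_irr /= [X in _ || X]andbC orbb.
by apply: contraNF uv => /andP[/eqP<- /eqP<-].
Qed.

Lemma sub_add_edge : subrel e add_edge.
Proof. by move=> x y xy; rewrite /add_edge /= xy. Qed.

Lemma add_edge_neq (x y : V) : x != u -> y != u -> add_edge x y = e x y.
Proof. by move=> /negPf xu /negPf yu; rewrite /add_edge /= xu yu !andbF !orbF. Qed.

End AddEdge.

Lemma leq_degree (V : finType) (e e' : rel V) (x : V) :
  subrel e e' -> degree e x <= degree e' x.
Proof.
by move=> ee'; apply/subset_leq_card/subsetP=> y; rewrite !inE; apply: ee'.
Qed.

Lemma has_bipartite_hole_sub (V : finType) (e e' : rel V) (s t : nat) :
  subrel e e' -> has_bipartite_hole e' s t -> has_bipartite_hole e s t.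
Proof.
move=> ee' /existsP[A /existsP[B /and4P[AB sA tB /forallP h]]].
apply/existsP; exists A; apply/existsP; exists B; rewrite /bipartite_hole AB sA tB /=.
apply/forallP=> x; apply/implyP=> xA; apply/forallP=> y; apply/implyP=> yB.
have /implyP/(_ xA)/forallP/(_ y)/implyP/(_ yB) := h x.
by apply: contraNN; apply: ee'.
Qed.

(* A cycle through [u] and [v] using the new edge is a [u]-[v] path of [e],
   which [path_closing] closes up within [e]. *)
Lemma cycle_remove_edge (V : finType) (e : rel V) (u v : V) (c : seq V) (s t : nat) :
  symmetric e -> irreflexive e -> 0 < s -> 0 < t -> ~~ has_bipartite_hole e s t ->
  s + t <= (degree e u).+1 -> s + t <= (degree e v).+1 ->
  graph_cycle (add_edge e u v) c -> u \in c ->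
  exists c', graph_cycle e c' /\ {subset c <= c'}.
Proof.
move=> e_sym e_irr s0 t0 noh du dv /andP[c3 /andP[cyc uc]] u_c.
case/rot_to: (u_c) => i q rE.
have sub_rot d : {subset u :: q <= d} -> {subset c <= d}.
  by move=> h x xc; apply: h; rewrite -rE mem_rot.
have {cyc} : cycle (add_edge e u v) (u :: q) by rewrite -rE rot_cycle.
have {uc} : uniq (u :: q) by rewrite -rE rot_uniq.
have {c3} : 2 < size (u :: q) by rewrite -rE size_rot.
case: q {rE} sub_rot => // y q sub_rot /= q2 /and3P[uyq yq uq] /andP[uy].
rewrite rcons_path => /andP[pq qu].
(* The new edge is incident to [u], so the cycle without [u] is already a path of [e]. *)
have {}pq : path e y q.
  have : {in y :: q, forall x, x != u} by move=> x; apply: contraTneq => ->.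
  elim: q y pq {sub_rot q2 uyq yq uq uy qu} => //= z q IH y /andP[yz zq] nu.
  rewrite IH //; last by move=> x xq; apply: nu; rewrite inE xq orbT.
  by rewrite andbT -(@add_edge_neq _ _ u v) ?nu ?inE ?eqxx ?orbT.
have lq : last y q \in q by case: q q2 {sub_rot uyq yq uq qu pq} => //= z q _; apply: mem_last.
have neq : y != last y q by apply: contraNneq yq => {1}->.
have yu : y != u by apply: contraNneq uyq => <-; rewrite mem_head.
have lu : last y q != u by apply: contraNneq uyq => <-; rewrite inE lq orbT.
rewrite /add_edge /= eqxx (negPf yu) (negPf lu) !andbT ?andbF ?orbF /= in uy qu.
(* If [v] follows [u] on the cycle, close up the path from [v] round to [u]; if it precedes [u], the
   path from [u] to [v]. Otherwise both cycle edges at [u] are old and the cycle itself serves. *)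
have [yv|yv] := eqVneq y v.
  rewrite -yv eq_sym (negPf neq) orbF in qu; rewrite -yv in dv.
  have [c' [cc' sc']] : exists c', graph_cycle e c' /\ {subset y :: rcons q u <= c'}.
    apply: uniq_path_closing e_sym e_irr _ _ _ s0 t0 noh dv _; rewrite ?last_rcons //.
    - by rewrite rcons_path pq.
    - by rewrite -rcons_cons rcons_uniq uyq /= yq.
    - by rewrite size_rcons.
  exists c'; split=> //; apply: sub_rot => x xq; apply: sc'.
  by rewrite -rcons_cons mem_rcons.
rewrite (negPf yv) orbF in uy.
have [lv|lv] := eqVneq (last y q) v.
  rewrite -lv in dv.
  have [|||c' [cc' sc']] :=
    @uniq_path_closing V e u (y :: q) s t e_sym e_irr _ _ _ s0 t0 noh du dv.
  - by rewrite /= uy.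
  - by rewrite /= uyq yq.
  - by [].
  by exists c'; split=> //; apply: sub_rot.
rewrite (negPf lv) orbF in qu.
exists [:: u, y & q]; split; last exact: sub_rot.
by rewrite /graph_cycle /ucycleb q2 /= rcons_path uy pq qu uyq yq.
Qed.

(** [H] stays fixed during the induction: adding edges only raises degrees and destroys holes, so
    the hypotheses persist. *)
Lemma heavy_cycle (V : finType) (e : rel V) (H : {set V}) (s t : nat) :
  symmetric e -> irreflexive e -> 0 < s -> 0 < t -> ~~ has_bipartite_hole e s t ->
  {in H, forall x, s + t <= (degree e x).+1} -> 2 < #|H| ->
  exists c, graph_cycle e c /\ {subset H <= c}.
Proof.
move=> e_sym e_irr s0 t0 noh dH H3.
(* The pairs are ordered, so an added edge removes two of them; the induction only needs a strict
   decrease. *)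
pose missing (r : rel V) := [set p in setX H H | (p.1 != p.2) && ~~ r p.1 p.2].
have [m] := ubnP #|missing e|.
elim: m e e_sym e_irr noh dH => // m IH e e_sym e_irr noh dH mm.
have [m0|[[u v]]] := set_0Vmem (missing e).
  apply: clique_cycle => // x y xH yH xy; apply: contraTT isT => nxy.
  by have := in_set0 (x, y); rewrite -m0 !inE /= xH yH xy nxy.
rewrite !inE /= => /andP[/andP[uH vH] /andP[uv nuv]].
have [|||||c [cc Hc]] := IH (add_edge e u v).
- exact: add_edge_sym.
- exact: add_edge_irr.
- by apply: contraNN noh; apply: has_bipartite_hole_sub; apply: sub_add_edge.
- move=> x xH; apply: leq_trans (dH x xH) _.
  by rewrite ltnS leq_degree //; apply: sub_add_edge.
- rewrite ltnS in mm; apply: leq_trans mm; apply/proper_card/properP; split.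
    apply/subsetP=> p; rewrite !inE => /andP[-> /andP[-> ]] /=.
    by apply: contraNN; apply: sub_add_edge.
  by exists (u, v); rewrite !inE /= ?uH ?vH ?uv ?nuv //= /add_edge /= !eqxx orbT.
have [c' [cc' sc]] :=
  cycle_remove_edge e_sym e_irr s0 t0 noh (dH u uH) (dH v vH) cc (Hc u uH).
by exists c'; split=> // x /Hc/sc.
Qed.

(** * Case split on the number of vertices of large degree *)

Theorem theorem1p4 (V : finType) (e : rel V)
    (e_sym : symmetric e) (e_irr : irreflexive e)
    (e_2conn : two_connected e) :
  exists c : seq V,
    graph_cycle e c /\
    (forall x : V, bipartite_hole_number e <= degree e x -> x \in c).
Proof.
rewrite /bipartite_hole_number; case: ex_minnP => k.
case/avoids_hole_sumP=>[s [t [s0 t0 st noh]]] _.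
pose H := [set x | k <= degree e x].
have dH : {in H, forall x, s + t <= (degree e x).+1} by move=> x; rewrite inE st.
suff [c [cc Hc]] : exists c, graph_cycle e c /\ {subset H <= c}.
  by exists c; split=> // x kx; apply: Hc; rewrite inE.
have [H3|] := ltnP 2 #|H|; first exact: heavy_cycle e_sym e_irr s0 t0 noh dH H3.
rewrite leq_eqVlt => /orP[/cards2P[x [y [xy HE]]]|H1].
  have [p [xp lp up p2]] := two_connected_path e_sym e_2conn xy.
  have [||c [cc pc]] := uniq_path_closing e_sym e_irr xp up p2 s0 t0 noh.
  - by apply: dH; rewrite HE !inE eqxx.
  - by apply: dH; rewrite lp HE !inE eqxx orbT.
  exists c; split=> // z; rewrite HE !inE => /orP[] /eqP->; apply: pc.
    exact: mem_head.
  by rewrite -lp mem_last.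
(* With at most one vertex in [H], any cycle through a suitable [x] will do; [x] is arbitrary if [H]
   is empty. *)
have [x xH] : exists x, {subset H <= [:: x]}.
  rewrite ltnS in H1; have [->|[x xH]] := set_0Vmem H.
    have /card_gt0P[x _] : 0 < #|V| by case/and3P: e_2conn => /ltnW/ltnW.
    by exists x => y; rewrite inE.
  by exists x => y yH; rewrite inE (card_le1_eqP H1 y x).
have [y xy] : exists y, x != y.
  apply/existsP; case/and3P: e_2conn => /ltnW V2 _ _; move: V2.
  rewrite -cardsT => /card_gt1P[a [b [_ _ ab]]]; apply/existsP.
  have [->|xa] := eqVneq x a; first by exists b.
  by exists a.
(* This path only provides a neighbour [z] of [x]; a second path from [x] to [z], with at least
   three vertices, is closed by the edge between them. *)
have [p [xp _ up p2]] := two_connected_path e_sym e_2conn xy.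
case: p xp up p2 => // z p /andP[xz _] _ _.
have {}xz_neq : x != z by apply: contraTneq xz => <-; rewrite e_irr.
have [q [xq lq uq q2]] := two_connected_path e_sym e_2conn xz_neq.
exists (x :: q); split=> [|w /xH]; last by rewrite !inE => ->.
by rewrite /graph_cycle /ucycleb ltnS q2 /= rcons_path xq lq e_sym xz.
Qed.
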